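(* Let $A\in\mathcal{C}^{n\times n}$ be diagonalizable with eigenvalues $\nu_1,\dots,\nu_n\in\mathcal{R}$ (with multiplicity) that are at most finite and satisfy $$1=\nu_1[0]>|\nu_2[0]|\ge\dots\ge|\nu_n[0]|.$$ Let $\mathbf x\in\mathcal{C}^n$ be written as $\mathbf x=\mathbf w_1+\dots+\mathbf w_n$ with $A\mathbf w_j=\nu_j\mathbf w_j$, and assume (i) all $\mathbf w_j$ have at most finite entries and (ii) $\mathbf w_1[0]\neq\mathbf 0$. Then for $\mathbf x_k:=A^k\mathbf x$, $$\frac{\mathbf x_k}{\|\mathbf x_k\|_2}\xrightarrow{wk}\frac{\mathbf w_1}{\|\mathbf w_1\|_2}.$$
   Context: The Levi-Civita field $\mathcal{R}$ (resp. $\mathcal{C}$) is the set of functions $a:\mathbb Q\to\mathbb R$ (resp. $\mathbb C$) with left-finite support (for every $r\in\mathbb Q$ only finitely many $q<r$ with $a(q)\ne0$), written $a[q]:=a(q)$; addition is pointwise, multiplication is $(ab)[q]=\sum_{q_1+q_2=q}a[q_1]b[q_2]$; $\mathcal{R}$ is a real closed ordered field ($a\succ b$ iff $(a-b)[\lambda(a-b)]>0$) and $\mathcal{C}=\mathcal{R}(i)$ is algebraically closed. $\lambda(a)=\min\{q:a[q]\ne0\}$ ($\lambda(0)=+\infty$); $a$ is at most finite if $\lambda(a)\ge0$. Absolute value: on $\mathcal{R}$, $|a|=a$ if $a\succeq0$ and $-a$ otherwise; on $\mathcal{C}$, $|a+ib|=\sqrt{a^2+b^2}$ for $a,b\in\mathcal{R}$.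 For $r\in\mathbb Q$, $\|a\|_r:=\sup_{q\le r}|a[q]|\in\mathbb R$. Weak convergence $a_n\xrightarrow{wk}a$: for every real $r>0$ there is $N_0$ with $\|a_n-a\|_{1/r}<r$ for all $n>N_0$. For vectors, weak convergence is coordinatewise, $\mathbf x[0]:=(\mathbf x^1[0],\dots,\mathbf x^n[0])\in\mathbb C^n$, and $\|\mathbf x\|_2=\sqrt{|\mathbf x^1|^2+\dots+|\mathbf x^n|^2}$. *)

(* Defs.v *)
From HB Require Import structures.
From mathcomp Require Import all_boot all_order all_algebra.
From mathcomp Require Import all_classical all_reals.
From Stdlib Require Import ClassicalEpsilon.
Set Implicit Arguments. Unset Strict Implicit. Unset Printing Implicit Defensive.
Import Order.TTheory GRing.Theory Num.Theory.
Local Open Scope ring_scope.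
Local Open Scope classical_set_scope.

Section LeviCivita.
Variable R : realType.

(** Raw elements of the Levi-Civita field R: functions Q -> R. *)
Definition LCR := rat -> R.

Definition left_finite (a : LCR) : Prop :=
  forall r : rat, finite_set [set q : rat | q < r /\ a q != 0].

Definition lc0 : LCR := fun _ => 0.
Definition lc1 : LCR := fun q => if q == 0 then 1 else 0.
Definition lcadd (a b : LCR) : LCR := fun q => a q + b q.
Definition lcopp (a : LCR) : LCR := fun q => - a q.
(** (ab)[q] = sum_{q1+q2=q} a[q1] b[q2] (a finitely supported sum for
    left-finite a, b) *)
Definition lcmul (a b : LCR) : LCR :=
  fun q => (\sum_(q1 \in [set: rat]) a q1 * b (q - q1))%R.

Definition lcpos (a : LCR) : Prop :=
  exists q, 0 < a q /\ forall q', q' < q -> a q' = 0.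
Definition lcnonneg (a : LCR) : Prop := a = lc0 \/ lcpos a.

Definition at_most_finite (a : LCR) : Prop := forall q : rat, q < 0 -> a q = 0.

(** multiplicative inverse (the unique left-finite b with a b = 1) *)
Definition lcinv (a : LCR) : LCR :=
  epsilon (inhabits lc0) (fun b => left_finite b /\ lcmul a b = lc1).
(** square root of a nonnegative element (the unique nonnegative b with b^2 = a) *)
Definition lcsqrt (a : LCR) : LCR :=
  epsilon (inhabits lc0)
    (fun b => left_finite b /\ lcnonneg b /\ lcmul b b = a).

(** Elements of C = R(i): pairs (real part, imaginary part). *)
Definition LCC := (LCR * LCR)%type.
Definition lcc_lf (z : LCC) : Prop := left_finite z.1 /\ left_finite z.2.
Definition lcc_amf (z : LCC) : Prop := at_most_finite z.1 /\ at_most_finite z.2.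
Definition czero : LCC := (lc0, lc0).
Definition cone : LCC := (lc1, lc0).
Definition cadd (z w : LCC) : LCC := (lcadd z.1 w.1, lcadd z.2 w.2).
Definition csub (z w : LCC) : LCC := (lcadd z.1 (lcopp w.1), lcadd z.2 (lcopp w.2)).
Definition cmul (z w : LCC) : LCC :=
  (lcadd (lcmul z.1 w.1) (lcopp (lcmul z.2 w.2)),
   lcadd (lcmul z.1 w.2) (lcmul z.2 w.1)).
Definition cscale (s : LCR) (z : LCC) : LCC := (lcmul s z.1, lcmul s z.2).
Definition cabs (z : LCC) : LCR := lcsqrt (lcadd (lcmul z.1 z.1) (lcmul z.2 z.2)).

Definition matmul n (M N : 'I_n -> 'I_n -> LCC) : 'I_n -> 'I_n -> LCC :=
  fun i j => \big[cadd/czero]_(l < n) cmul (M i l) (N l j).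
Definition matvec n (M : 'I_n -> 'I_n -> LCC) (v : 'I_n -> LCC) : 'I_n -> LCC :=
  fun i => \big[cadd/czero]_(l < n) cmul (M i l) (v l).
Definition idmat n : 'I_n -> 'I_n -> LCC := fun i j => if i == j then cone else czero.
Definition diagmat n (nu : 'I_n -> LCR) : 'I_n -> 'I_n -> LCC :=
  fun i j => if i == j then (nu i, lc0) else czero.

Definition diagonalizable_with n (A : 'I_n -> 'I_n -> LCC) (nu : 'I_n -> LCR) : Prop :=
  exists P Q : 'I_n -> 'I_n -> LCC,
    (forall i j, lcc_lf (P i j)) /\ (forall i j, lcc_lf (Q i j)) /\
    matmul P Q = @idmat n /\ matmul Q P = @idmat n /\
    A = matmul (matmul P (diagmat nu)) Q.

Definition vpow n (A : 'I_n -> 'I_n -> LCC) (k : nat) (x : 'I_n -> LCC) : 'I_n -> LCC :=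
  iter k (matvec A) x.

Definition norm2 n (x : 'I_n -> LCC) : LCR :=
  lcsqrt (\big[lcadd/lc0]_(i < n) lcmul (cabs (x i)) (cabs (x i))).
Definition vnormalize n (x : 'I_n -> LCC) : 'I_n -> LCC :=
  fun i => cscale (lcinv (norm2 x)) (x i).

Definition coefnorm (c : LCC) (t : R) : R :=
  sup [set Num.sqrt (c.1 q ^+ 2 + c.2 q ^+ 2) | q in [set q : rat | ratr q <= t]].

Definition wk_conv (a : nat -> LCC) (l : LCC) : Prop :=
  forall r : R, 0 < r -> exists N : nat, forall k : nat, (N < k)%N ->
    coefnorm (csub (a k) l) r^-1 < r.
Definition vwk_conv n (a : nat -> 'I_n -> LCC) (l : 'I_n -> LCC) : Prop :=
  forall i, wk_conv (fun k => a k i) (l i).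

End LeviCivita.

(* Main.v *)
(** Dividing [A^k x] by the k-th power of the dominant eigenvalue (a positive unit)
    does not change its normalization and leaves [w_0 + sum_j mu_j^k w_j] with
    [|mu_j[0]| < 1]. All series involved have their support in one left-finite
    additive monoid [S] of nonnegative rationals, so that weak convergence can be tested
    coefficient by coefficient, by induction along [S]: for [mu_j^k -> 0] the
    coefficient at [q] obeys [u_{k+1} = mu_j[0] u_k + e_k], where [e_k -> 0] involves
    smaller exponents only; for inverses and square roots the coefficient at [q] is a
    continuous function of the data and of the coefficients at smaller exponents. *)
Require Import Defs.
From HB Require Import structures.
From mathcomp Require Import all_boot all_order all_algebra.
From mathcomp Require Import all_classical all_reals.
From mathcomp Require Import ring lra.
From mathcomp Require Import topology normedtype sequences realfun.
From Stdlib Require Import ClassicalEpsilon.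
Set Implicit Arguments. Unset Strict Implicit. Unset Printing Implicit Defensive.
Import Order.TTheory GRing.Theory Num.Theory.
Import numFieldNormedType.Exports.
Local Open Scope ring_scope.
Local Open Scope classical_set_scope.

(** * Left-finite sets and the ring laws for left-finite functions *)

Section LeftFiniteRing.
Variable R : realType.
Implicit Types a b c : LCR R.

Definition lf_set (S : set rat) := forall r : rat, finite_set [set q | q < r /\ S q].

Lemma finite_set_uniq (T : choiceType) (A : set T) : finite_set A ->
  exists2 s : seq T, uniq s & forall x, x \in s <-> A x.
Proof.
by move=> /finite_seqP[s ->]; exists (undup s) => [|x]; rewrite ?undup_uniq ?mem_undup.
Qed.

Lemma lf_setS (S T : set rat) : S `<=` T -> lf_set T -> lf_set S.
Proof.
by move=> ST lfT r; apply: sub_finite_set (lfT r) => q [qr Sq]; split=> //; exact: ST.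
Qed.

Lemma lf_setU (S T : set rat) : lf_set S -> lf_set T -> lf_set (S `|` T).
Proof.
move=> lfS lfT r; have := conj (lfS r) (lfT r); rewrite -finite_setU.
by apply: sub_finite_set => q [qr [Sq|Tq]]; [left|right].
Qed.

Lemma lf_set1 (x : rat) : lf_set [set x].
Proof. by move=> r; apply: sub_finite_set (finite_set1 x) => q []. Qed.

Lemma lf_set_bigcup (I : finType) (F : I -> set rat) : (forall i, lf_set (F i)) ->
  lf_set (\bigcup_i F i).
Proof.
move=> lfF r; apply: (@sub_finite_set _ _ (\bigcup_i [set q | q < r /\ F i q])).
  by move=> q [qr [i _ Fq]]; exists i.
by apply: bigcup_finite => [|i _]; [exact: finite_finset|exact: lfF].
Qed.

(** The elements of [S] below [q + 1] form a finite list containing [q]. The least element of that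
    list is the least element of [S], since everything else in [S] is at least [q + 1]. *)
Lemma lf_set_min (S : set rat) q : lf_set S -> S q ->
  exists2 m, S m & forall p, S p -> m <= p.
Proof.
move=> /(_ (q + 1)) /finite_set_uniq[s _ sP] Sq.
have qs : q \in s by apply/sP; split=> //=; rewrite ltrDl.
have [m ms mle] : exists2 m, m \in s & forall p, p \in s -> m <= p.
  elim: (s) q qs {sP Sq} => // x [|y l] IH q _.
    by exists x; rewrite ?mem_head// => p /[!inE] /eqP->.
  have [|m ml mle] := IH y; first exact: mem_head.
  have [xm|mx] := leP x m.
    exists x; first exact: mem_head.
    by move=> p /[1!inE] /orP[/eqP->//|/mle]; exact: le_trans.
  exists m; first by rewrite inE ml orbT.
  by move=> p /[1!inE] /orP[/eqP->|/mle//]; exact: ltW.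
have /sP[mq Sm] := ms; exists m => // p Sp.
have [pq|qp] := ltP p (q + 1); last by apply: le_trans qp; exact: ltW.
by apply: mle; apply/sP.
Qed.

Lemma lf_set_lb (S : set rat) : lf_set S -> exists m, forall q, S q -> m <= q.
Proof.
move=> lfS; have [[q Sq]|S0] := pselect (exists q, S q).
  by have [m _ mS] := lf_set_min lfS Sq; exists m.
by exists 0 => q Sq; case: S0; exists q.
Qed.

(** Both sets are bounded below, say by [m] and [m']. A sum below [r] then forces its terms below
    [r - m'] and [r - m], which leaves finitely many pairs. *)
Lemma lf_setD (S T : set rat) : lf_set S -> lf_set T ->
  lf_set [set p + q | p in S & q in T].
Proof.
move=> lfS lfT r; have [m mS] := lf_set_lb lfS; have [m' mT] := lf_set_lb lfT.
apply: sub_finite_set (finite_image2 (fun p q => p + q) (lfS (r - m')) (lfT (r - m))).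
move=> _ [/[swap] [[p Sp [q Tq <-]]] pqr]; have := mS _ Sp; have := mT _ Tq => h1 h2.
by exists p; [split=> //; lra | exists q; [split=> //; lra|]].
Qed.

Definition supp a : set rat := [set q | a q != 0].

Lemma suppN0 a q : ~ supp a q -> a q = 0.
Proof. by move=> /negP; rewrite negbK => /eqP. Qed.

Lemma lcmul_seq (s : seq rat) a b q : uniq s ->
  (forall p, supp a p -> supp b (q - p) -> p \in s) ->
  lcmul a b q = \sum_(p <- s) a p * b (q - p).
Proof.
move=> us hs; rewrite /lcmul (fsbigE s)//; last first.
  move=> p _; apply: contraNeq; rewrite mulf_eq0 negb_or => /andP[ap bp].
  exact: hs.
by apply: eq_bigl => p; rewrite in_setT.
Qed.

(** The index list depends on [a], [m] and [q] alone, so different second factors and different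
    exponents can share it. This is what allows products to be added and summations to be
    exchanged. *)
Lemma lcmul_lf_seq a m q : left_finite a ->
  exists2 s : seq rat, uniq s & forall b q', q' <= q -> (forall p, supp b p -> m <= p) ->
    lcmul a b q' = \sum_(p <- s) a p * b (q' - p).
Proof.
move=> /(_ (q - m + 1)) /finite_set_uniq[s us sE]; exists s => // b q' qq' mb.
by apply: lcmul_seq => // p ap /mb bp; apply/sE; split=> //=; lra.
Qed.

Lemma lcmulC a b : lcmul a b = lcmul b a.
Proof.
apply/funext => q; rewrite /lcmul (reindex_fsbigT (fun p => q - p)); last first.
  by exists (fun p => q - p) => p; rewrite opprB addrCA subrr addr0.
by apply: eq_fsbigr => p _; rewrite opprB addrCA subrr addr0 mulrC.
Qed.

Lemma supp_lcmul a b : left_finite a -> left_finite b ->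
  supp (lcmul a b) `<=` [set p + q | p in supp a & q in supp b].
Proof.
move=> lfa lfb q; have [m mb] := lf_set_lb lfb.
have [s us sE] := lcmul_lf_seq m q lfa.
rewrite /supp/= sE//; apply: contraNP => h; apply/eqP; apply: big1 => p _.
apply/eqP/negPn/negP; rewrite mulf_eq0 negb_or => /andP[ap bp].
by apply: h; exists p => //; exists (q - p) => //; rewrite addrC subrK.
Qed.

Lemma left_finite_mul a b : left_finite a -> left_finite b -> left_finite (lcmul a b).
Proof. by move=> lfa lfb; apply: lf_setS (supp_lcmul lfa lfb) (lf_setD lfa lfb). Qed.

(** With [c] innermost on both sides, this law is a plain exchange of two finite sums, over the
    supports of [a] and of [b]. Associativity follows from it by commutativity. *)
Lemma lcmulCA a b c : left_finite a -> left_finite b -> left_finite c ->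
  lcmul a (lcmul b c) = lcmul b (lcmul a c).
Proof.
move=> lfa lfb lfc; apply/funext => q.
have [ma ha] := lf_set_lb lfa; have [mb hb] := lf_set_lb lfb.
have [mc hc] := lf_set_lb lfc.
have lb u v mu mv : left_finite u -> left_finite v -> (forall p, supp u p -> mu <= p) ->
    (forall p, supp v p -> mv <= p) -> forall p, supp (lcmul u v) p -> mu + mv <= p.
  by move=> fu fv hu hv _ /supp_lcmul[]// p /hu pu [r /hv rv <-]; apply: lerD.
(* [M] bounds from above every exponent at which a product is evaluated, and [- M] bounds from below
   the supports of [c], [a c] and [b c]. One list for [a] and one for [b] therefore serve in all the
   sums. *)
pose M := `|q| + `|ma| + `|mb| + `|mc| + `|q - ma| + `|q - mb|.
have [sa ua sEa] := lcmul_lf_seq (- M) M lfa.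
have [sb ub sEb] := lcmul_lf_seq (- M) M lfb.
have bnd : [/\ q <= M, - M <= mc, -M <= ma + mc & - M <= mb + mc] /\ (q - ma <= M /\ q - mb <= M).
  rewrite /M; have := ler_norm q; have := ler_norm (-ma); have := ler_norm (-mb).
  have := ler_norm (-mc); have := ler_norm (q - ma); have := ler_norm (q - mb).
  rewrite !normrN; have := normr_ge0 q; have := normr_ge0 ma; have := normr_ge0 mb.
  have := normr_ge0 mc; have := normr_ge0 (q - ma); have := normr_ge0 (q - mb).
  by move=> *; do !split; lra.
case: bnd => [[qM cM acM bcM] [qaM qbM]].
rewrite sEa//; last by move=> p /(lb _ _ mb mc lfb lfc hb hc); exact: le_trans.
rewrite sEb//; last by move=> p /(lb _ _ ma mc lfa lfc ha hc); exact: le_trans.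
have hc' p : supp c p -> - M <= p by move=> /hc; exact: le_trans.
transitivity (\sum_(p <- sa) \sum_(r <- sb) a p * (b r * c (q - p - r))).
  apply: eq_bigr => p _; have [->|ap] := eqVneq (a p) 0.
    by rewrite mul0r big1// => r _; rewrite mul0r.
  rewrite sEb ?mulr_sumr//; have := ha _ ap; lra.
rewrite exchange_big; apply: eq_bigr => r _; have [->|br] := eqVneq (b r) 0.
  by rewrite mul0r big1// => p _; rewrite mul0r mulr0.
rewrite sEa ?mulr_sumr//; last by have := hb _ br; lra.
by apply: eq_bigr => p _; rewrite mulrCA addrAC.
Qed.

Lemma lcmulA a b c : left_finite a -> left_finite b -> left_finite c ->
  lcmul a (lcmul b c) = lcmul (lcmul a b) c.
Proof. by move=> *; rewrite (lcmulC b) lcmulCA// lcmulC. Qed.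

Lemma lcmulDl a b c : left_finite a -> left_finite b -> left_finite c ->
  lcmul (lcadd a b) c = lcadd (lcmul a c) (lcmul b c).
Proof.
move=> lfa lfb lfc; rewrite -!(lcmulC c); apply/funext => q.
have [m hm] := lf_set_lb (lf_setU lfa lfb).
have [s us sE] := lcmul_lf_seq m q lfc.
have sub p : supp (lcadd a b) p -> (supp a `|` supp b) p.
  by apply: contraPP => /not_orP[/suppN0 ap /suppN0 bp]; rewrite /supp/= /lcadd ap bp addr0 eqxx.
rewrite /lcadd !sE//.
- by rewrite -big_split/=; apply: eq_bigr => p _; rewrite mulrDr.
- by move=> p bp; apply: hm; right.
- by move=> p ap; apply: hm; left.
by move=> p /sub/hm.
Qed.

(** The monomial of exponent [t]: multiplying by it shifts exponents by [t]. *)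
Definition lcmono (t : rat) : LCR R := fun q => if q == t then 1 else 0.

Lemma left_finite_mono t : left_finite (lcmono t).
Proof.
apply: lf_setS (lf_set1 t) => q; rewrite /supp/= /lcmono.
by case: (q =P t) => //; rewrite eqxx.
Qed.

Lemma lcmul_mono t a q : lcmul (lcmono t) a q = a (q - t).
Proof.
rewrite (lcmul_seq (s := [:: t]))//; first by rewrite big_seq1 /lcmono eqxx mul1r.
by move=> p; rewrite /supp/= /lcmono inE; case: (p =P t) => //; rewrite eqxx.
Qed.

Lemma lc1E : lc1 R = lcmono 0. Proof. by []. Qed.

Lemma lcmul1 a : lcmul (lc1 R) a = a.
Proof. by apply/funext => q; rewrite lc1E lcmul_mono subr0. Qed.

Lemma left_finite0 : left_finite (lc0 R).
Proof. by move=> r; apply: sub_finite_set (finite_set0 _) => q [_ /eqP]. Qed.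

Lemma left_finite_add a b : left_finite a -> left_finite b -> left_finite (lcadd a b).
Proof.
move=> lfa lfb; apply: lf_setS (lf_setU lfa lfb) => q.
by apply: contraPP => /not_orP[/suppN0 ap /suppN0 bp]; rewrite /supp/= /lcadd ap bp addr0 eqxx.
Qed.

Lemma left_finite_opp a : left_finite a -> left_finite (lcopp a).
Proof. by apply: lf_setS => q; rewrite /supp/= /lcopp oppr_eq0. Qed.

End LeftFiniteRing.

(** * The commutative ring of left-finite functions *)

Record lcf (R : realType) := Lcf { lcoef :> LCR R; lcf_lf : left_finite lcoef }.

Section LcfRing.
Variable R : realType.
Implicit Types a b c : lcf R.

Lemma lcf_inj a b : lcoef a = lcoef b -> a = b.
Proof.
case: a b => [a fa] [b fb] /= ab; case: _ / ab in fb *.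
by congr Lcf; exact: Prop_irrelevance.
Qed.

HB.instance Definition _ := gen_eqMixin (lcf R).
HB.instance Definition _ := gen_choiceMixin (lcf R).

Definition lcf_zero : lcf R := Lcf (@left_finite0 R).
Definition lcf_add a b : lcf R := Lcf (left_finite_add (lcf_lf a) (lcf_lf b)).
Definition lcf_opp a : lcf R := Lcf (left_finite_opp (lcf_lf a)).
Definition lcf_mono t : lcf R := Lcf (@left_finite_mono R t).
Definition lcf_mul a b : lcf R := Lcf (left_finite_mul (lcf_lf a) (lcf_lf b)).

Fact lcf_addA : associative lcf_add.
Proof. by move=> a b c; apply/lcf_inj/funext => q; exact: addrA. Qed.
Fact lcf_addC : commutative lcf_add.
Proof. by move=> a b; apply/lcf_inj/funext => q; exact: addrC. Qed.
Fact lcf_add0 : left_id lcf_zero lcf_add.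
Proof. by move=> a; apply/lcf_inj/funext => q; exact: add0r. Qed.
Fact lcf_addN : left_inverse lcf_zero lcf_opp lcf_add.
Proof. by move=> a; apply/lcf_inj/funext => q; exact: addNr. Qed.

HB.instance Definition _ :=
  GRing.isZmodule.Build (lcf R) lcf_addA lcf_addC lcf_add0 lcf_addN.

Fact lcf_mulA : associative lcf_mul.
Proof. by move=> a b c; apply/lcf_inj/lcmulA; exact: lcf_lf. Qed.
Fact lcf_mulC : commutative lcf_mul.
Proof. by move=> a b; apply/lcf_inj/lcmulC. Qed.
Fact lcf_mul1 : left_id (lcf_mono 0) lcf_mul.
Proof. by move=> a; apply/lcf_inj/lcmul1. Qed.
Fact lcf_mulDl : left_distributive lcf_mul +%R.
Proof. by move=> a b c; apply/lcf_inj/lcmulDl; exact: lcf_lf. Qed.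
Fact lcf_mono0_neq0 : lcf_mono 0 != 0 :> lcf R.
Proof.
apply/eqP => /(congr1 (fun a => lcoef a 0)) /=.
by rewrite /lcmono eqxx => /eqP; rewrite oner_eq0.
Qed.

HB.instance Definition _ := GRing.Zmodule_isComNzRing.Build (lcf R)
  lcf_mulA lcf_mulC lcf_mul1 lcf_mulDl lcf_mono0_neq0.

Lemma lcf_valM a b : lcoef (a * b) = lcmul a b. Proof. by []. Qed.
Lemma lcf_val1 : lcoef 1 = lc1 R. Proof. by []. Qed.

Lemma lcfD a b q : lcoef (a + b) q = lcoef a q + lcoef b q. Proof. by []. Qed.
Lemma lcf_sum (I : Type) (r : seq I) (F : I -> lcf R) q :
  lcoef (\sum_(i <- r) F i) q = \sum_(i <- r) lcoef (F i) q.
Proof. by elim: r => [|i r IH]; rewrite ?big_nil// !big_cons lcfD IH. Qed.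
Lemma lcf_val_sum (I : Type) (r : seq I) (F : I -> lcf R) :
  lcoef (\sum_(i <- r) F i) = \big[@lcadd R/lc0 R]_(i <- r) lcoef (F i).
Proof. by elim: r => [|i r IH]; rewrite ?big_nil// !big_cons -IH. Qed.

Lemma lcf_monoM t a q : lcoef (lcf_mono t * a) q = lcoef a (q - t).
Proof. exact: lcmul_mono. Qed.

Lemma lcf_mono_mul s t : lcf_mono s * lcf_mono t = lcf_mono (s + t).
Proof.
by apply/lcf_inj/funext => q; rewrite lcf_monoM /= /lcmono subr_eq [t + s]addrC.
Qed.

End LcfRing.

(** * Left-finite additive monoids of exponents *)

Definition exponent_monoid (S : set rat) :=
  [/\ lf_set S, S 0, forall q, S q -> 0 <= q & forall p q, S p -> S q -> S (p + q)].

Lemma finite_sums_bounded_size (F : set rat) n : finite_set F ->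
  finite_set [set q | exists2 s : seq rat,
    (size s <= n)%N /\ (forall p, p \in s -> F p) & q = \sum_(p <- s) p].
Proof.
move=> finF; elim: n => [|n IH].
  apply: sub_finite_set (finite_set1 0) => _ [[|p s] [//= _ _] ->].
  by rewrite big_nil.
(* Adjoining 0 lets the empty list, too, split as a first term plus a shorter list. *)
have finF0 : finite_set (F `|` [set 0]) by rewrite finite_setU; split.
apply: sub_finite_set (finite_image2 (fun p q => p + q) finF0 IH).
move=> _ [[|p s] [/= sn sF] ->].
  exists 0; first by right.
  by exists 0; rewrite ?addr0 ?big_nil//; exists [::]; rewrite ?big_nil.
exists p; first by left; apply: sF; exact: mem_head.
exists (\sum_(i <- s) i); last by rewrite big_cons.
by exists s => //; split=> // i si; apply: sF; rewrite inE si orbT.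
Qed.

(** [S] consists of the finite sums of positive elements of [T]. If [e] is the least positive
    element, a sum below [r] has fewer than [r / e] terms, each below [r], so only finitely many
    such sums exist. *)
Lemma exponent_monoid_gen (T : set rat) : lf_set T -> (forall q, T q -> 0 <= q) ->
  exists2 S, exponent_monoid S & T `<=` S.
Proof.
move=> lfT T0; pose T' := [set q | T q /\ 0 < q].
exists [set q | exists2 s : seq rat, forall p, p \in s -> T' p & q = \sum_(p <- s) p].
  have sum_ge0 (s : seq rat) : (forall p, p \in s -> T' p) -> 0 <= \sum_(p <- s) p.
    by move=> sT; rewrite big_seq sumr_ge0// => p /sT[_ /ltW].
  split.
  - move=> r; have [[t T't]|T'0] := pselect (exists t, T' t); last first.
      apply: sub_finite_set (finite_set1 0) => _ [_ [[|p s] sT ->]] /=.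
        by rewrite big_nil.
      by case: T'0; exists p; apply: sT; exact: mem_head.
    have lfT' : lf_set T' by apply: lf_setS lfT => q [].
    have [e [Te e0] emin] := lf_set_min lfT' T't.
    pose N := Num.bound (r / e).
    have finF := lfT' r.
    apply: sub_finite_set (finite_sums_bounded_size N finF) => q [qr [s sT qE]].
    exists s => //; split.
      have le_size : (size s)%:R * e <= \sum_(p <- s) p.
        elim: (s) sT => [|p l IH] sT; first by rewrite mul0r big_nil.
        rewrite big_cons /= -natr1 mulrDl mul1r addrC lerD//.
          by apply/emin/sT/mem_head.
        by apply: IH => x xl; apply: sT; rewrite inE xl orbT.
      have : (size s)%:R < r / e by rewrite ltr_pdivlMr//; apply: le_lt_trans le_size _; rewrite -qE.
      move=> sN; rewrite -(ler_nat rat); apply/ltW/(lt_trans sN)/archi_boundP.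
      exact: le_trans (ltW sN).
    move=> p ps; split; last exact: sT.
    apply: le_lt_trans qr; rewrite qE (big_rem p)//= lerDl sum_ge0//.
    by move=> x /mem_rem/sT.
  - by exists [::]; rewrite ?big_nil.
  - by move=> q [s sT ->]; exact: sum_ge0.
  move=> p q [s sT ->] [s' sT' ->]; exists (s ++ s'); last by rewrite big_cat.
  by move=> x; rewrite mem_cat => /orP[/sT|/sT'].
move=> q Tq; have := T0 _ Tq; rewrite le_eqVlt => /orP[/eqP<-|q0].
  by exists [::]; rewrite ?big_nil.
by exists [:: q]; rewrite ?big_seq1// => p /[!inE] /eqP->.
Qed.

(** * Recursion along an exponent monoid; existence of inverses and square roots *)

Section Exponents.
Variables (R : realType) (S : set rat).
Hypothesis hS : exponent_monoid S.
Implicit Types a b c : lcf R.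

Definition below (q : rat) : seq rat :=
  finmap.enum_fset (fset_set [set p | p <= q /\ S p]).

Lemma below_uniq q : uniq (below q). Proof. exact: finmap.fset_uniq. Qed.

Lemma mem_below p q : (p \in below q) = `[< p <= q /\ S p >].
Proof.
rewrite /below in_fset_set; first by apply/idP/asboolP; rewrite inE.
case: hS => /(_ (q + 1)) + _ _ _; apply: sub_finite_set => x [xq Sx].
by split=> //=; apply: le_lt_trans xq _; rewrite ltrDl.
Qed.

Lemma exponent_ge0 q : S q -> 0 <= q. Proof. by case: hS => _ _ + _; apply. Qed.

Lemma exponent0 : S 0. Proof. by case: hS. Qed.

Lemma size_below_lt p q : S q -> p < q -> (size (below p) < size (below q))%N.
Proof.
move=> Sq pq; apply: uniq_leq_size (_ : uniq (q :: below p)) _.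
  rewrite /= below_uniq andbT mem_below; apply/asboolP => -[/le_lt_trans/(_ pq)].
  by rewrite ltxx.
move=> x; rewrite inE => /orP[/eqP->|]; rewrite !mem_below.
  by apply/asboolP; split.
by move=> /asboolP[xp Sx]; apply/asboolP; split=> //; apply: le_trans xp (ltW pq).
Qed.

(** The number of elements of [S] up to [q] is finite and strictly increases along [S], so it serves
    as the rank of a strong induction. *)
Lemma exponent_ind (P : rat -> Prop) :
  (forall q, S q -> (forall p, S p -> p < q -> P p) -> P q) -> forall q, S q -> P q.
Proof.
move=> IH q; have [n] := ubnP (size (below q)); elim: n q => // n IHn q qn Sq.
apply: IH => // p Sp pq; apply: IHn => //.
by apply: leq_trans (size_below_lt Sq pq) _.
Qed.

(* The n-th iterate of the recursion is already correct at the exponents having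
   fewer than n exponents below them. *)
Lemma exponent_rec (F : rat -> LCR R -> R) :
  (forall q f g, S q -> (forall p, p < q -> f p = g p) -> F q f = F q g) ->
  exists2 b : lcf R, supp b `<=` S & forall q, S q -> lcoef b q = F q b.
Proof.
move=> Floc; pose step (f : LCR R) : LCR R := fun q => if `[< S q >] then F q f else 0.
pose it n := iter n step (fun=> 0).
have it_off n q : ~ S q -> it n q = 0.
  by case: n => // n Sq; rewrite /it/= /step asboolF.
have it_eq n m q : S q -> (size (below q) <= n)%N -> (size (below q) <= m)%N ->
    it n q = it m q.
  elim: n m q => [m q Sq|n IH [|m] q Sq hn hm].
  - rewrite leqn0 size_eq0 => /eqP b0.
    by have := mem_below q q; rewrite b0 asboolT.
  - by move: hm; rewrite leqn0 size_eq0 => /eqP b0; have := mem_below q q; rewrite b0 asboolT.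
  rewrite /it/= /step asboolT//; apply: Floc => // p pq.
  have [Sp|Sp] := pselect (S p); last by rewrite -/(it n) -/(it m) !it_off.
  by apply: IH => //; have := leq_trans (size_below_lt Sq pq) hn;
    have := leq_trans (size_below_lt Sq pq) hm; rewrite !ltnS.
pose b : LCR R := fun q => it (size (below q)) q.
have bS : supp b `<=` S by move=> q; apply: contraNP => /it_off bq; rewrite /b bq.
have lfb : left_finite b by apply: lf_setS bS _; case: hS.
exists (Lcf lfb) => // q Sq /=; rewrite /b (it_eq _ (size (below q)).+1)//.
rewrite {1}/it/= /step asboolT//; apply: Floc => // p pq; rewrite -/(it _).
have [Sp|Sp] := pselect (S p); last by rewrite !it_off.
by apply: it_eq => //; apply/ltnW/size_below_lt.
Qed.

Lemma supp_mulS a b : supp a `<=` S -> supp b `<=` S -> supp (lcoef (a * b)) `<=` S.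
Proof.
move=> aS bS q /(supp_lcmul (lcf_lf a) (lcf_lf b))[p /aS Sp [r /bS Sr <-]].
by case: hS => _ _ _; apply.
Qed.

Lemma supp_addS a b : supp a `<=` S -> supp b `<=` S -> supp (lcoef (a + b)) `<=` S.
Proof.
move=> aS bS q; rewrite /supp /mkset lcfD; apply: contraNP => Sq.
by rewrite (suppN0 (fun h => Sq (aS _ h))) (suppN0 (fun h => Sq (bS _ h))) addr0.
Qed.

Lemma supp_0S : supp (lcoef (0 : lcf R)) `<=` S.
Proof. by move=> q; rewrite /supp/= eqxx. Qed.

Lemma supp_1S : supp (lcoef (1 : lcf R)) `<=` S.
Proof.
move=> q; rewrite /supp/= /lcmono; have [->|] := eqVneq q 0; last by rewrite eqxx.
by move=> _; exact: exponent0.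
Qed.

Lemma supp_expS a k : supp a `<=` S -> supp (lcoef (a ^+ k)) `<=` S.
Proof.
by move=> aS; elim: k => [|k IH]; rewrite ?exprS; [exact: supp_1S|exact: supp_mulS].
Qed.

Lemma lcoef_mul a b q : supp a `<=` S -> supp b `<=` S ->
  lcoef (a * b) q = \sum_(p <- below q) lcoef a p * lcoef b (q - p).
Proof.
move=> aS bS; apply: lcmul_seq; first exact: below_uniq.
move=> p /aS Sp /bS /exponent_ge0; rewrite subr_ge0 => pq.
by rewrite mem_below; apply/asboolP.
Qed.

(** The remaining sum evaluates [b] only at exponents smaller than [q], so a known product
    determines the coefficients of [b] recursively as soon as [lcoef a 0] is nonzero. *)
Lemma lcoef_mulD1 a b q : supp a `<=` S -> supp b `<=` S -> S q ->
  lcoef (a * b) q = lcoef a 0 * lcoef b q +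
    \sum_(p <- below q | p != 0) lcoef a p * lcoef b (q - p).
Proof.
move=> aS bS Sq; rewrite lcoef_mul// (bigD1_seq 0) ?below_uniq//= ?subr0//.
by rewrite mem_below; apply/asboolP; split; [exact: exponent_ge0|exact: exponent0].
Qed.

(** The variant used for squares: with [a = b], the two extreme terms combine to twice the
    coefficient at 0 times the coefficient at [q]. *)
Lemma lcoef_mulD2 a b q : supp a `<=` S -> supp b `<=` S -> S q -> q != 0 ->
  lcoef (a * b) q = lcoef a 0 * lcoef b q + lcoef a q * lcoef b 0 +
    \sum_(p <- below q | (p != 0) && (p != q)) lcoef a p * lcoef b (q - p).
Proof.
move=> aS bS Sq q0; rewrite lcoef_mulD1// -addrA; congr (_ + _).
rewrite -big_filter (bigD1_seq q) ?filter_uniq ?below_uniq//=; last first.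
  by rewrite mem_filter q0/= mem_below; apply/asboolP.
by rewrite subrr big_filter_cond.
Qed.

Lemma lcoef_mul0 a b : supp a `<=` S -> supp b `<=` S ->
  lcoef (a * b) 0 = lcoef a 0 * lcoef b 0.
Proof.
move=> aS bS; rewrite lcoef_mulD1 ?big1_seq ?addr0//; last exact: exponent0.
move=> p /andP[p0]; rewrite mem_below => /asboolP[ple0 /exponent_ge0 pge0].
by case/eqP: p0; apply/le_anti/andP.
Qed.

Lemma lcoef_exp0 a k : supp a `<=` S -> lcoef (a ^+ k) 0 = lcoef a 0 ^+ k.
Proof.
move=> aS; elim: k => [|k IH]; first by rewrite !expr0 /= /lcmono eqxx.
by rewrite !exprS lcoef_mul0 ?IH//; exact: supp_expS.
Qed.

(** [F] solves the coefficient equation of [a * b = 1] at [q] for the coefficient of [b] at [q]. *)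
Lemma lcf_inv_exists a : supp a `<=` S -> lcoef a 0 != 0 ->
  exists2 b : lcf R, supp b `<=` S & a * b = 1.
Proof.
move=> aS a0.
pose F q (f : LCR R) := (lcoef (1 : lcf R) q -
  \sum_(p <- below q | p != 0) lcoef a p * f (q - p)) / lcoef a 0.
have [|b bS bE] := @exponent_rec F.
  move=> q f g Sq fg; rewrite /F; congr ((_ - _) / _).
  rewrite big_seq_cond [RHS]big_seq_cond; apply: eq_bigr => p /andP[+ p0].
  rewrite mem_below => /asboolP[pq /exponent_ge0 pge0].
  by rewrite fg// ltrBlDr ltrDl lt_neqAle eq_sym p0.
exists b => //; apply/lcf_inj/funext => q; have [Sq|Sq] := pselect (S q).
  by rewrite lcoef_mulD1// [lcoef b q]bE// /F mulrC divfK// subrK.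
by rewrite (suppN0 (fun h => Sq (supp_mulS aS bS h))) (suppN0 (fun h => Sq (@supp_1S q h))).
Qed.

(** The recursion starts from the positive real root at exponent 0. At any other [q] the equation of
    [b * b = a] is linear in the coefficient at [q], with leading factor twice that root. *)
Lemma lcf_sqrt_exists a : supp a `<=` S -> 0 < lcoef a 0 ->
  exists b : lcf R, [/\ supp b `<=` S, 0 < lcoef b 0 & b * b = a].
Proof.
move=> aS a0; have s0 : 0 < Num.sqrt (lcoef a 0) by rewrite sqrtr_gt0.
pose F q (f : LCR R) := if q == 0 then Num.sqrt (lcoef a 0) else
  (lcoef a q - \sum_(p <- below q | (p != 0) && (p != q)) f p * f (q - p)) /
  (2 * Num.sqrt (lcoef a 0)).
have [|b bS bE] := @exponent_rec F.
  move=> q f g Sq fg; rewrite /F; case: ifP => // q0; congr ((_ - _) / _).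
  rewrite big_seq_cond [RHS]big_seq_cond; apply: eq_bigr => p /and3P[+ p0 pq].
  rewrite mem_below => /asboolP[pleq /exponent_ge0 pge0].
  by rewrite !fg// ?ltrBlDr ?ltrDl lt_neqAle ?[0 == p]eq_sym ?p0 ?pq.
have b0 : lcoef b 0 = Num.sqrt (lcoef a 0) by rewrite bE /F ?eqxx//; exact: exponent0.
exists b; split=> //; first by rewrite b0.
apply/lcf_inj/funext => q; have [Sq|Sq] := pselect (S q); last first.
  by rewrite (suppN0 (fun h => Sq (supp_mulS bS bS h))) (suppN0 (fun h => Sq (aS _ h))).
have [->|q0] := eqVneq q 0; first by rewrite lcoef_mul0// b0 -expr2 sqr_sqrtr// ltW.
rewrite lcoef_mulD2// [lcoef b q]bE// b0 /F (negbTE q0).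
set X := \sum_(_ <- _ | _) _; field; exact: lt0r_neq0.
Qed.

End Exponents.

(** * Limits of real sequences *)

Lemma cvg_sum_seq (R : realType) (I : eqType) (s : seq I) (P : pred I)
    (f : nat -> I -> R) (g : I -> R) :
  (forall i, i \in s -> P i -> f k i @[k --> \oo] --> g i) ->
  \sum_(i <- s | P i) f k i @[k --> \oo] --> \sum_(i <- s | P i) g i.
Proof.
elim: s => [|i s IH] fg.
  by under eq_fun do rewrite big_nil; rewrite big_nil; exact: cvg_cst.
under eq_fun do rewrite big_cons; rewrite big_cons.
have {}IH : \sum_(i <- s | P i) f k i @[k --> \oo] --> \sum_(i <- s | P i) g i.
  by apply: IH => j js; apply: fg; rewrite inE js orbT.
by case: ifP => // Pi; apply: cvgD => //; apply: fg => //; exact: mem_head.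
Qed.

Lemma cvg_sqrt (R : realType) (u : nat -> R) (l : R) :
  u k @[k --> \oo] --> l -> Num.sqrt (u k) @[k --> \oo] --> Num.sqrt l.
Proof. by move=> ul; exact: (cvg_comp _ _ ul (@sqrt_continuous R l)). Qed.

Lemma cvg_contracting_rec (R : realType) (c : R) (u e : nat -> R) : `|c| < 1 ->
  (forall k, u k.+1 = c * u k + e k) -> e k @[k --> \oo] --> 0 -> u k @[k --> \oo] --> 0.
Proof.
move=> c1 uE e0; apply/cvgr0Pnorm_le => eps eps0.
(* With errors of this size, [eps / 2] is a fixed point of the majorizing recursion
   [t -> |c| t + d]. The surplus over it decays geometrically. *)
have d0 : 0 < (1 - `|c|) * (eps / 2) by rewrite mulr_gt0 ?divr_gt0 ?subr_gt0.
have /cvgr0Pnorm_le/(_ _ d0)[N _ hN] := e0.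
have bnd m : `|u (m + N)%N| <= geometric `|u N| `|c| m + eps / 2.
  elim: m => [|m IH] /=; first by rewrite add0n expr0 mulr1 lerDl divr_ge0// ltW.
  rewrite addSn uE; apply: le_trans (ler_normD _ _) _; rewrite normrM exprSr.
  have /= he := hN (m + N)%N (leq_addl _ _).
  have := ler_wpM2l (normr_ge0 c) IH; rewrite /=; nra.
have c1' : `| `|c| | < 1 by rewrite normr_id.
have e20 : 0 < eps / 2 by rewrite divr_gt0.
have /cvgr0Pnorm_le/(_ _ e20)[M _ hM] := cvg_geometric `|u N| c1'.
exists (M + N)%N => // k /= hk; have Nk : (N <= k)%N by apply: leq_trans hk; exact: leq_addl.
rewrite -(subnK Nk); apply: le_trans (bnd _) _.
have := hM (k - N)%N; rewrite /= leq_subRL// addnC => /(_ hk).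
by move=> /(le_trans (ler_norm _)); lra.
Qed.

(** * Convergence of families supported in a common exponent monoid *)

Section SupportedConvergence.
Variables (R : realType) (S : set rat).
Hypothesis hS : exponent_monoid S.
Implicit Types (a b c l m : lcf R) (u v : nat -> lcf R).

(* Weak convergence of a family supported in one left-finite set is coefficientwise. *)
Definition scvg u l := [/\ forall k, supp (u k) `<=` S, supp l `<=` S &
  forall q, lcoef (u k) q @[k --> \oo] --> lcoef l q].

Lemma scvg_exponents u l : (forall k, supp (u k) `<=` S) -> supp l `<=` S ->
  (forall q, S q -> lcoef (u k) q @[k --> \oo] --> lcoef l q) -> scvg u l.
Proof.
move=> uS lS ul; split=> // q; have [/ul//|Sq] := pselect (S q).
rewrite (suppN0 (fun h => Sq (lS _ h))).
by under eq_fun do rewrite (suppN0 (fun h => Sq (uS _ _ h))); exact: cvg_cst.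
Qed.

Lemma scvg_cst a : supp a `<=` S -> scvg (fun=> a) a.
Proof. by move=> aS; split=> // q; exact: cvg_cst. Qed.

Lemma scvgD u v l m : scvg u l -> scvg v m -> scvg (fun k => u k + v k) (l + m).
Proof.
move=> [uS lS ul] [vS mS vm]; split; [move=> k| |]; try exact: supp_addS.
by move=> q; apply: cvgD.
Qed.

Lemma scvgM u v l m : scvg u l -> scvg v m -> scvg (fun k => u k * v k) (l * m).
Proof.
move=> [uS lS ul] [vS mS vm]; split; [move=> k| |]; try exact: supp_mulS.
move=> q; rewrite (lcoef_mul hS)//; under eq_fun do rewrite (lcoef_mul hS)//.
by apply: cvg_sum_seq => p _ _; apply: cvgM.
Qed.

Lemma scvg_sum (I : Type) (s : seq I) (U : I -> nat -> lcf R) (L : I -> lcf R) :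
  (forall i, scvg (U i) (L i)) -> scvg (fun k => \sum_(i <- s) U i k) (\sum_(i <- s) L i).
Proof.
move=> UL; elim: s => [|i s IH].
  by rewrite big_nil; under eq_fun do rewrite big_nil; apply: scvg_cst; exact: supp_0S.
by rewrite big_cons; under eq_fun do rewrite big_cons; exact: scvgD.
Qed.

Lemma scvg_exp0 a : supp a `<=` S -> `|lcoef a 0| < 1 -> scvg (fun k => a ^+ k) 0.
Proof.
move=> aS a0; apply: scvg_exponents => [k||]; [exact: supp_expS|exact: supp_0S|].
apply: (exponent_ind hS) => q Sq IH; apply: cvg_contracting_rec a0 _ _.
  by move=> k; rewrite exprS (lcoef_mulD1 hS)//; exact: supp_expS.
have sum0 : \sum_(p <- below S q | p != 0) lcoef a p * 0 = 0.
  by apply: big1 => p _; rewrite mulr0.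
rewrite -[X in _ --> X]sum0.
apply: cvg_sum_seq => p; rewrite (mem_below hS) => /asboolP[pq Sp] p0.
apply: cvgM; first exact: cvg_cst.
(* [q - p] need not lie in [S]; when it does not, every coefficient there vanishes. When it does, it
   is smaller than [q] because [p] is positive. *)
have [Sqp|Sqp] := pselect (S (q - p)).
  apply: IH => //; rewrite ltrBlDr ltrDl lt_neqAle eq_sym p0; exact: (exponent_ge0 hS).
under eq_fun do rewrite (suppN0 (fun h => Sqp (supp_expS hS aS h))).
exact: cvg_cst.
Qed.

(** The formula [step] holds for any inverse supported in [S], hence for each [v k] and for [m]
    alike, and its right-hand side passes to the limit by induction. *)
Lemma scvg_inv u v l m : scvg u l -> (forall k, supp (v k) `<=` S) -> supp m `<=` S ->
  (forall k, u k * v k = 1) -> l * m = 1 -> scvg v m.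
Proof.
move=> [uS lS ul] vS mS uv lm; apply: scvg_exponents => //.
have inv0 a b : supp a `<=` S -> supp b `<=` S -> a * b = 1 -> lcoef a 0 * lcoef b 0 = 1.
  by move=> aS bS; rewrite -(lcoef_mul0 hS)// => -> /=; rewrite /lcmono eqxx.
have step a b q : supp a `<=` S -> supp b `<=` S -> S q -> a * b = 1 ->
    lcoef b q = (lcoef (1 : lcf R) q -
      \sum_(p <- below S q | p != 0) lcoef a p * lcoef b (q - p)) / lcoef a 0.
  move=> aS bS Sq ab; have h := inv0 _ _ aS bS ab.
  have a0 : lcoef a 0 != 0.
    by apply/eqP => a0; move: h; rewrite a0 mul0r => /esym/eqP; rewrite oner_eq0.
  by rewrite -ab (lcoef_mulD1 hS)// addrK mulrC mulrA mulVf// mul1r.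
apply: (exponent_ind hS) => q Sq IH; rewrite (step l m)//.
under eq_fun => k do rewrite (step (u k) (v k))//.
apply: cvgM; last first.
  apply: cvgV => //; apply/eqP => l0; have := inv0 _ _ lS mS lm.
  by rewrite l0 mul0r => /esym/eqP; rewrite oner_eq0.
apply: cvgB; first exact: cvg_cst.
apply: cvg_sum_seq => p; rewrite (mem_below hS) => /asboolP[pq Sp] p0.
apply: cvgM; first exact: ul.
have [Sqp|Sqp] := pselect (S (q - p)).
  apply: IH => //; rewrite ltrBlDr ltrDl lt_neqAle eq_sym p0; exact: (exponent_ge0 hS).
rewrite (suppN0 (fun h => Sqp (mS _ h))).
under eq_fun do rewrite (suppN0 (fun h => Sqp (vS _ _ h))).
exact: cvg_cst.
Qed.

(** Positivity at exponent 0 fixes the sign of the root, so the coefficient there is the real square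
    root, which is continuous. The higher coefficients follow from [step] as for inverses. *)
Lemma scvg_sqrt u v l m : scvg u l -> (forall k, supp (v k) `<=` S) -> supp m `<=` S ->
  (forall k, 0 < lcoef (v k) 0) -> 0 < lcoef m 0 ->
  (forall k, v k * v k = u k) -> m * m = l -> scvg v m.
Proof.
move=> [uS lS ul] vS mS v0 m0 vu ml; apply: scvg_exponents => //.
have base a b : supp b `<=` S -> 0 < lcoef b 0 -> b * b = a ->
    lcoef b 0 = Num.sqrt (lcoef a 0).
  by move=> bS b0 <-; rewrite (lcoef_mul0 hS)// -expr2 sqrtr_sqr gtr0_norm.
have step a b q : supp b `<=` S -> 0 < lcoef b 0 -> S q -> q != 0 -> b * b = a ->
    lcoef b q = (lcoef a q - \sum_(p <- below S q | (p != 0) && (p != q))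
      lcoef b p * lcoef b (q - p)) / (2 * lcoef b 0).
  move=> bS b0 Sq q0 <-; rewrite (lcoef_mulD2 hS)// addrK.
  by field; exact: lt0r_neq0.
apply: (exponent_ind hS) => q Sq IH; have [q0|q0] := eqVneq q 0.
  rewrite q0 (base l)//; under eq_fun => k do rewrite (base (u k))//.
  exact: cvg_sqrt.
rewrite (step l)//; under eq_fun => k do rewrite (step (u k))//.
have IH0 : lcoef (v k) 0 @[k --> \oo] --> lcoef m 0.
  apply: IH; first exact: exponent0.
  by rewrite lt_neqAle eq_sym q0/=; exact: (exponent_ge0 hS).
apply: cvgM; last first.
  apply: cvgV; first by rewrite mulf_neq0// lt0r_neq0.
  by apply: cvgM => //; exact: cvg_cst.
apply: cvgB; first exact: ul.
apply: cvg_sum_seq => p; rewrite (mem_below hS) => /asboolP[pleq Sp] /andP[p0 pq].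
apply: cvgM; first by apply: IH => //; rewrite lt_neqAle pq.
have [Sqp|Sqp] := pselect (S (q - p)).
  apply: IH => //; rewrite ltrBlDr ltrDl lt_neqAle eq_sym p0; exact: (exponent_ge0 hS).
rewrite (suppN0 (fun h => Sqp (mS _ h))).
under eq_fun do rewrite (suppN0 (fun h => Sqp (vS _ _ h))).
exact: cvg_cst.
Qed.

(** The supremum up to [1/r] involves only the finitely many exponents of [S] in that range, so
    pointwise convergence is uniform there. *)
Lemma scvg_wk_conv u v l m : scvg u l -> scvg v m ->
  wk_conv (fun k => (lcoef (u k), lcoef (v k))) (lcoef l, lcoef m).
Proof.
move=> [uS lS ul] [vS mS vm] r r0.
pose Q : rat := (Num.bound r^-1)%:R.
pose f k q := Num.sqrt ((lcoef (u k) q - lcoef l q) ^+ 2 + (lcoef (v k) q - lcoef m q) ^+ 2).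
have fcvg q : f k q @[k --> \oo] --> (0 : R).
  rewrite -[X in _ --> X](@sqrtr0 R); apply: cvg_sqrt.
  have sub0 (w : nat -> R) z : w k @[k --> \oo] --> z -> (w k - z) ^+ 2 @[k --> \oo] --> (0 : R).
    move=> /subr_cvg0 wz; rewrite -[X in _ --> X](mul0r 0).
    by under eq_fun do rewrite expr2; exact: cvgM.
  by rewrite -[X in _ --> X](addr0 0); apply: cvgD; exact: sub0.
have [N hN] : exists N, forall k, (N < k)%N -> forall q, q \in below S Q -> f k q <= r / 2.
  elim: (below S Q) => [|q s [N IH]]; first by exists 0%N.
  have r20 : 0 < r / 2 by rewrite divr_gt0.
  have /cvgr0Pnorm_le/(_ _ r20)[M _ hM] := fcvg q.
  exists (maxn N M) => k; rewrite gtn_max => /andP[Nk Mk] p /[1!inE] /orP[/eqP->|].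
    by apply: le_trans (ler_norm _) _; apply: hM; exact: ltnW.
  exact: IH.
(* A supremum inherits only non-strict bounds, hence the margin [r / 2]. The bound also needs a
   nonempty set, to which exponent 0 contributes. *)
exists N => k Nk; apply: (@le_lt_trans _ _ (r / 2)); last lra.
apply: ge_sup.
  by exists (f k 0), 0 => //=; rewrite rmorph0 invr_ge0 ltW.
move=> _ [q /= qr <-]; rewrite -/(f k q).
have [Sq|Sq] := pselect (S q).
  apply: hN => //; rewrite (mem_below hS); apply/asboolP; split=> //.
  rewrite -(ler_rat R); apply: le_trans qr _; rewrite ratr_nat; apply/ltW/archi_boundP.
  by rewrite invr_ge0 ltW.
rewrite /f (suppN0 (fun h => Sq (lS _ h))) (suppN0 (fun h => Sq (mS _ h))).
rewrite (suppN0 (fun h => Sq (uS _ _ h))) (suppN0 (fun h => Sq (vS _ _ h))).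
by rewrite subrr expr0n addr0 sqrtr0 divr_ge0// ltW.
Qed.

End SupportedConvergence.

(** * Identification of the chosen inverses, square roots and norms *)

Section InverseAndRoot.
Variable R : realType.
Implicit Types a b t : lcf R.

Lemma lcf_eq0 a : (forall q, ~ supp a q) -> a = 0.
Proof. by move=> a0; apply/lcf_inj/funext => q; exact/suppN0/a0. Qed.

(** If [p] and [q] are the least exponents of [a] and [b], the coefficient of the product at [p + q]
    is the single product of the two leading coefficients. *)
Lemma lcf_mul_eq0 a b : a * b = 0 -> a = 0 \/ b = 0.
Proof.
move=> ab; have [[p ap]|a0] := pselect (exists p, supp a p); last first.
  by left; apply: lcf_eq0 => q aq; apply: a0; exists q.
have [[q bq]|b0] := pselect (exists q, supp b q); last first.
  by right; apply: lcf_eq0 => q bq; apply: b0; exists q.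
have [{ap}p ap pmin] := lf_set_min (lcf_lf a) ap.
have [{bq}q bq qmin] := lf_set_min (lcf_lf b) bq.
have : lcoef (a * b) (p + q) = 0 by rewrite ab.
rewrite lcf_valM (lcmul_seq (s := [:: p]))//.
  rewrite big_seq1 addrAC subrr add0r => /eqP; rewrite mulf_eq0.
  by move: ap bq; rewrite /supp/= => /negbTE-> /negbTE->.
move=> r /pmin pr /qmin; rewrite inE => qr.
by apply/eqP/le_anti; rewrite pr andbT; lra.
Qed.

(** The existence of [u] makes the element chosen by [epsilon] an inverse of [t], and inverses in a
    commutative ring are unique. *)
Lemma lcinvE t u : t * u = 1 -> lcinv (lcoef t) = lcoef u.
Proof.
move=> tu; rewrite /lcinv; set P := (X in epsilon _ X).
have [lfb tb] : P (epsilon (inhabits (lc0 R)) P).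
  apply: epsilon_spec; exists (lcoef u); split; first exact: lcf_lf.
  by rewrite -lcf_valM tu.
move: (epsilon _ _) lfb tb => b lfb tb.
have {}tb : t * Lcf lfb = 1 by exact: lcf_inj.
rewrite -[b]/(lcoef (Lcf lfb)); congr lcoef.
by rewrite -[LHS]mul1r -tu mulrAC tb mul1r.
Qed.

(** The chosen root [b] satisfies [(b - t) (b + t) = 0], and [b = - t] would contradict the
    nonnegativity of [b]. *)
Lemma lcsqrtE t : at_most_finite t -> 0 < lcoef t 0 -> lcsqrt (lcoef (t * t)) = lcoef t.
Proof.
move=> tfin t0; rewrite /lcsqrt; set P := (X in epsilon _ X).
have [lfb [bnn bb]] : P (epsilon (inhabits (lc0 R)) P).
  apply: epsilon_spec; exists (lcoef t); split; first exact: lcf_lf.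
  by split=> //; right; exists 0; split.
move: (epsilon _ _) lfb bnn bb => b lfb bnn bb.
have {}bb : Lcf lfb * Lcf lfb = t * t by exact: lcf_inj.
have /lcf_mul_eq0[] : (Lcf lfb - t) * (Lcf lfb + t) = 0.
  by rewrite mulrDr !mulrBl bb; ring.
  by move/eqP; rewrite subr_eq0 => /eqP <-.
move/eqP; rewrite addr_eq0 => /eqP bt; exfalso.
have bE q : b q = - lcoef t q by rewrite -[b]/(lcoef (Lcf lfb)) bt.
case: bnn => [b0|[q [bq blow]]].
  by move: (bE 0); rewrite b0 => /esym/eqP; rewrite oppr_eq0 (gt_eqF t0).
(* [q] is the leading exponent of [b = - t]. It cannot be negative, as [t] is at most finite; nor
   positive, as [t] is nonzero at 0; and at 0 the signs disagree. *)
have [q0|q0|q0] := ltgtP q 0.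
- by move: bq; rewrite bE tfin// oppr0 ltxx.
- by move: (blow _ q0); rewrite bE => /eqP; rewrite oppr_eq0 (gt_eqF t0).
- by move: bq; rewrite bE q0 oppr_gt0 ltNge (ltW t0).
Qed.

Lemma sum_sqr_gt0 (x y : R) : x != 0 \/ y != 0 -> 0 < x ^+ 2 + y ^+ 2.
Proof.
move=> xy; rewrite lt_neqAle addr_ge0 ?sqr_ge0// andbT eq_sym paddr_eq0 ?sqr_ge0//.
by rewrite !sqrf_eq0 negb_and; apply/orP.
Qed.

(** Dividing by the monomial of the least exponent [r] in either support moves both supports to
    nonnegative exponents and makes the sum of squares positive at 0. Its root is then shifted back
    by [r]. *)
Lemma lcf_sqrt_sum_sqr a b : exists c : lcf R, lcnonneg c /\ c * c = a * a + b * b.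
Proof.
have [[q abq]|ab0] := pselect (exists q, (supp a `|` supp b) q); last first.
  have -> : a = 0 by apply: lcf_eq0 => q aq; apply: ab0; exists q; left.
  have -> : b = 0 by apply: lcf_eq0 => q bq; apply: ab0; exists q; right.
  by exists 0; split; [left|rewrite !mul0r addr0].
have [r abr rmin] := lf_set_min (lf_setU (lcf_lf a) (lcf_lf b)) abq.
pose a' := lcf_mono R (- r) * a; pose b' := lcf_mono R (- r) * b.
have a'E q' : lcoef a' q' = lcoef a (q' + r) by rewrite lcf_monoM opprK.
have b'E q' : lcoef b' q' = lcoef b (q' + r) by rewrite lcf_monoM opprK.
have [||S hS abS] := exponent_monoid_gen (T := supp a' `|` supp b').
- by apply: lf_setU; exact: lcf_lf.
- move=> p; rewrite /supp /setU /mkset a'E b'E => -[h|h].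
    by have := rmin (p + r) (or_introl h); lra.
  by have := rmin (p + r) (or_intror h); lra.
have a'S : supp a' `<=` S by move=> p ?; apply: abS; left.
have b'S : supp b' `<=` S by move=> p ?; apply: abS; right.
have [||c' [c'S c'0 c'E]] := lcf_sqrt_exists hS (a := a' * a' + b' * b').
- by apply: supp_addS; exact: (supp_mulS hS).
- rewrite lcfD (lcoef_mul0 hS a'S a'S) (lcoef_mul0 hS b'S b'S) a'E b'E add0r -!expr2.
  exact: sum_sqr_gt0.
have shiftK z : lcf_mono R r * (lcf_mono R (- r) * z) = z.
  by rewrite mulrA lcf_mono_mul subrr mul1r.
exists (lcf_mono R r * c'); split; last first.
  by rewrite mulrACA c'E -[in RHS](shiftK a) -[in RHS](shiftK b) -/a' -/b'; ring.
right; exists r; split; first by rewrite lcf_monoM subrr.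
move=> p pr; rewrite lcf_monoM; apply: suppN0 => /c'S/(exponent_ge0 hS).
by rewrite subr_ge0 leNgt pr.
Qed.

Lemma cabs_sqr a b : lcmul (cabs (lcoef a, lcoef b)) (cabs (lcoef a, lcoef b)) =
  lcoef (a * a + b * b).
Proof.
rewrite /cabs /lcsqrt; set P := (X in epsilon _ X).
have [_ []//] : P (epsilon (inhabits (lc0 R)) P).
have [c [cnn cE]] := lcf_sqrt_sum_sqr a b.
apply: epsilon_spec; exists (lcoef c); split; first exact: lcf_lf.
by split=> //; rewrite -lcf_valM cE.
Qed.

(** Moduli enter [norm2] only through their squares, which [cabs_sqr] makes polynomial. The
    conditions on [t] then single out the root taken by [lcsqrt]. *)
Lemma norm2E n (Z1 Z2 : 'I_n -> lcf R) t : at_most_finite t -> 0 < lcoef t 0 ->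
  t * t = \sum_i (Z1 i * Z1 i + Z2 i * Z2 i) ->
  norm2 (fun i => (lcoef (Z1 i), lcoef (Z2 i))) = lcoef t.
Proof.
move=> tfin t0 tE; rewrite -(lcsqrtE tfin t0) tE lcf_val_sum /norm2; congr lcsqrt.
by apply: eq_bigr => i _; rewrite cabs_sqr.
Qed.

End InverseAndRoot.

(** * Powers of the matrix on eigenvector sums, and the power iteration *)

Section Iteration.
Variables (R : realType).

Lemma big_cadd (I : Type) (r : seq I) (F G : I -> lcf R) :
  \big[@cadd R/czero R]_(i <- r) (lcoef (F i), lcoef (G i)) =
  (lcoef (\sum_(i <- r) F i), lcoef (\sum_(i <- r) G i)).
Proof. by elim: r => [|i r IH]; rewrite ?big_nil// !big_cons IH. Qed.

Lemma matvecE n (A1 A2 : 'I_n -> 'I_n -> lcf R) (V1 V2 : 'I_n -> lcf R) :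
  matvec (fun i l => (lcoef (A1 i l), lcoef (A2 i l)))
         (fun l => (lcoef (V1 l), lcoef (V2 l))) =
  fun i => (lcoef (\sum_l (A1 i l * V1 l - A2 i l * V2 l)),
            lcoef (\sum_l (A1 i l * V2 l + A2 i l * V1 l))).
Proof. by apply/funext => i; rewrite -big_cadd; apply: eq_bigr. Qed.

Lemma vpow_eigen n (A1 A2 : 'I_n -> 'I_n -> lcf R) (nu : 'I_n -> lcf R)
    (W1 W2 : 'I_n -> 'I_n -> lcf R) k :
  (forall j i, \sum_l (A1 i l * W1 j l - A2 i l * W2 j l) = nu j * W1 j i) ->
  (forall j i, \sum_l (A1 i l * W2 j l + A2 i l * W1 j l) = nu j * W2 j i) ->
  vpow (fun i l => (lcoef (A1 i l), lcoef (A2 i l))) k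
    (fun i => (lcoef (\sum_j W1 j i), lcoef (\sum_j W2 j i))) =
  fun i => (lcoef (\sum_j nu j ^+ k * W1 j i), lcoef (\sum_j nu j ^+ k * W2 j i)).
Proof.
move=> e1 e2; elim: k => [|k IH].
  apply/funext => i; congr (lcoef _, lcoef _).
    by apply: eq_bigr => j _; rewrite mul1r.
  by apply: eq_bigr => j _; rewrite mul1r.
rewrite /vpow iterS -/(vpow _ k _) IH matvecE.
apply/funext => i; congr (lcoef _, lcoef _).
  under eq_bigr do rewrite !mulr_sumr -sumrB.
  rewrite exchange_big; apply: eq_bigr => j _.
  by rewrite exprSr -mulrA -e1 mulr_sumr; apply: eq_bigr => l _; ring.
under eq_bigr do rewrite !mulr_sumr -big_split.
rewrite exchange_big; apply: eq_bigr => j _.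
by rewrite exprSr -mulrA -e2 mulr_sumr; apply: eq_bigr => l _ /=; ring.
Qed.

Lemma scvg_shift (S : set rat) (u : nat -> lcf R) l N : scvg S u l ->
  scvg S (fun k => u (k + N)%N) l.
Proof. by move=> [uS lS ul]; split=> // q; rewrite (cvg_shiftn N (fun k => lcoef (u k) q)). Qed.

Lemma power_iteration n (S : set rat) (nu : 'I_n.+1 -> lcf R)
    (W1 W2 : 'I_n.+1 -> 'I_n.+1 -> lcf R) : exponent_monoid S ->
  (forall j, supp (nu j) `<=` S) ->
  (forall j i, supp (W1 j i) `<=` S) -> (forall j i, supp (W2 j i) `<=` S) ->
  lcoef (nu ord0) 0 = 1 -> (forall j : 'I_n.+1, (0 < j)%N -> `|lcoef (nu j) 0| < 1) ->
  (exists i, lcoef (W1 ord0 i) 0 != 0 \/ lcoef (W2 ord0 i) 0 != 0) ->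
  vwk_conv (fun k => vnormalize (fun i =>
     (lcoef (\sum_j nu j ^+ k * W1 j i), lcoef (\sum_j nu j ^+ k * W2 j i))))
    (vnormalize (fun i => (lcoef (W1 ord0 i), lcoef (W2 ord0 i)))).
Proof.
move=> hS nuS W1S W2S nu0 nuj [i0 Wi0].
have amf (t : lcf R) : supp t `<=` S -> at_most_finite (lcoef t).
  move=> tS q q0; apply: suppN0 => /tS/(exponent_ge0 hS).
  by rewrite leNgt q0.
(* [m] is the inverse of the dominant eigenvalue. Its coefficient at 0 is 1, so the quotients
   [nu j * m] keep the coefficients of [nu j] at 0. *)
have [|m mS num] := lcf_inv_exists hS (nuS ord0); first by rewrite nu0 oner_eq0.
have m0 : lcoef m 0 = 1.
  have := lcoef_mul0 hS (nuS ord0) mS; rewrite num nu0 mul1r => <-.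
  by rewrite lcf_val1 /lc1 eqxx.
have Ycvg (W : 'I_n.+1 -> 'I_n.+1 -> lcf R) i : (forall j i, supp (W j i) `<=` S) ->
    scvg S (fun k => \sum_j (nu j * m) ^+ k * W j i) (W ord0 i).
  (* The limit is rewritten as a sum over [j] so that convergence can be checked term by term:
     constant for [ord0], tending to 0 otherwise. *)
  move=> WS; have -> : W ord0 i = \sum_(j < n.+1) (if j == ord0 then W ord0 i else 0).
    by rewrite -big_mkcond big_pred1_eq.
  apply: scvg_sum => j; have [->|j0] := eqVneq j ord0.
    rewrite num; under eq_fun do rewrite expr1n mul1r.
    exact: scvg_cst.
  rewrite -[X in scvg _ _ X](mul0r (W j i)); apply: scvgM => //; last exact: scvg_cst.
  apply: scvg_exp0 => //; first exact: supp_mulS.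
  by rewrite (lcoef_mul0 hS)// m0 mulr1 nuj// lt0n.
pose Y (W : 'I_n.+1 -> 'I_n.+1 -> lcf R) k i : lcf R := \sum_j (nu j * m) ^+ k * W j i.
pose Q (Z1 Z2 : 'I_n.+1 -> lcf R) : lcf R := \sum_i (Z1 i * Z1 i + Z2 i * Z2 i).
have Qcvg : scvg S (fun k => Q (Y W1 k) (Y W2 k)) (Q (W1 ord0) (W2 ord0)).
  by apply: scvg_sum => i; apply: scvgD; apply: scvgM => //; exact: Ycvg.
have [QS QlS Qc] := Qcvg.
(* The coefficient at 0 is a sum of real squares, one of which is positive because the dominant
   eigenvector is nonzero at exponent 0. *)
have Q0 : 0 < lcoef (Q (W1 ord0) (W2 ord0)) 0.
  rewrite lcf_sum (bigD1 i0)// ltr_pwDl ?sumr_ge0//.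
    by rewrite lcfD !(lcoef_mul0 hS)// -!expr2 sum_sqr_gt0.
  by move=> i _; rewrite lcfD !(lcoef_mul0 hS)// -!expr2 addr_ge0// sqr_ge0.
(* Positivity of the squared norm at 0, required by the root, passes from the limit only to late
   indices. From here on [t] and [v] are indexed with the shift [N0]. *)
have [N0 hN0] : exists N, forall k, 0 < lcoef (Q (Y W1 (k + N)%N) (Y W2 (k + N)%N)) 0.
  have [N _ hN] := cvgr_gt _ (Qc 0) _ Q0.
  by exists N => k; apply: hN; exact: leq_addl.
have [T [TS T0 TE]] := lcf_sqrt_exists hS QlS Q0.
have [V VS TV] := lcf_inv_exists hS TS (lt0r_neq0 T0).
have /choice[t tP] k := lcf_sqrt_exists hS (QS _) (hN0 k).
have tS k : supp (t k) `<=` S by have [] := tP k.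
have t0 k : 0 < lcoef (t k) 0 by have [] := tP k.
have /choice[v vP] : forall k, exists b, supp (lcoef b) `<=` S /\ t k * b = 1.
  by move=> k; have [b bS tb] := lcf_inv_exists hS (tS k) (lt0r_neq0 (t0 k)); exists b.
have vcvg : scvg S v V.
  apply: (scvg_inv hS _ _ VS _ TV (u := t)) => [|k|k]; try by have [] := vP k.
  apply: (scvg_sqrt hS (scvg_shift N0 Qcvg)) => //.
  by move=> k; have [] := tP k.
move=> i r r0.
have [N hN] := scvg_wk_conv hS (scvgM hS vcvg (scvg_shift N0 (Ycvg _ i W1S)))
  (scvgM hS vcvg (scvg_shift N0 (Ycvg _ i W2S))) r0.
exists (N + N0)%N => k Nk.
have N0k : (N0 <= k)%N by apply: leq_trans (ltnW Nk); exact: leq_addl.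
have := hN (k - N0)%N; rewrite ltn_subRL addnC => /(_ Nk).
(* The power of the dominant eigenvalue is factored out by inserting [(nu ord0 * m) ^+ k = 1] into
   each term. *)
have XY W j : \sum_j' nu j' ^+ k * W j' j = nu ord0 ^+ k * Y W k j.
  rewrite mulr_sumr; apply: eq_bigr => j' _.
  by rewrite exprMn !mulrA -exprMn -[nu j' ^+ k]mul1r -[in LHS](expr1n _ k) -num !exprMn; ring.
suff -> : vnormalize (fun i => (lcoef (W1 ord0 i), lcoef (W2 ord0 i))) i =
    (lcoef (V * W1 ord0 i), lcoef (V * W2 ord0 i)).
  suff -> : vnormalize (fun i => (lcoef (\sum_j nu j ^+ k * W1 j i),
      lcoef (\sum_j nu j ^+ k * W2 j i))) i =
      (lcoef (v (k - N0)%N * Y W1 k i), lcoef (v (k - N0)%N * Y W2 k i)).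
    by rewrite subnK.
  have [_ _ tE] := tP (k - N0)%N; have [_ tv] := vP (k - N0)%N.
  (* The norm of the iterate is [nu ord0 ^+ k * t (k - N0)], positive at 0. Its inverse carries
     [m ^+ k], which cancels the factor extracted by [XY]. *)
  have tXE : (nu ord0 ^+ k * t (k - N0)%N) * (nu ord0 ^+ k * t (k - N0)%N) =
    Q (fun i => \sum_j nu j ^+ k * W1 j i) (fun i => \sum_j nu j ^+ k * W2 j i).
    rewrite mulrACA tE subnK// mulr_sumr; apply: eq_bigr => j _; rewrite !XY; ring.
  rewrite /vnormalize (norm2E _ _ tXE).
  - rewrite (@lcinvE _ _ (m ^+ k * v (k - N0)%N)); last first.
      by rewrite mulrACA tv mulr1 -exprMn num expr1n.
    rewrite /cscale /= -!lcf_valM !XY; congr (lcoef _, lcoef _).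
      by rewrite [_ * v _]mulrC -mulrA (mulrA _ _ (Y _ _ _)) -exprMn [m * _]mulrC num expr1n mul1r.
    by rewrite [_ * v _]mulrC -mulrA (mulrA _ _ (Y _ _ _)) -exprMn [m * _]mulrC num expr1n mul1r.
  - by apply/amf/(supp_mulS hS) => //; exact: supp_expS.
  by rewrite (lcoef_mul0 hS (supp_expS hS (nuS _)) (tS _)) (lcoef_exp0 hS)// nu0 expr1n mul1r.
by rewrite /vnormalize (norm2E (amf _ TS) T0 TE) (lcinvE TV).
Qed.

End Iteration.

(** * The convergence theorem for matrices and vectors of raw functions *)

Theorem mainTheorem8 (R : realType) (n : nat)
  (A : 'I_n.+1 -> 'I_n.+1 -> LCC R) (nu : 'I_n.+1 -> LCR R)
  (x : 'I_n.+1 -> LCC R) (w : 'I_n.+1 -> 'I_n.+1 -> LCC R) :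
  (forall i j, lcc_lf (A i j)) ->
  (forall j, left_finite (nu j)) ->
  (forall i, lcc_lf (x i)) ->
  (forall j i, lcc_lf (w j i)) ->
  diagonalizable_with A nu ->
  (forall j, at_most_finite (nu j)) ->
  nu ord0 0 = 1 ->
  (forall j : 'I_n.+1, (0 < j)%N -> `|nu j 0| < 1) ->
  (forall i j : 'I_n.+1, (0 < i)%N -> (i <= j)%N -> `|nu j 0| <= `|nu i 0|) ->
  x = (fun i => \big[@cadd R/czero R]_(j < n.+1) w j i) ->
  (forall j, matvec A (w j) = (fun i => cscale (nu j) (w j i))) ->
  (forall j i, lcc_amf (w j i)) ->
  (exists i, (w ord0 i).1 0 != 0 \/ (w ord0 i).2 0 != 0) ->
  vwk_conv (fun k => vnormalize (vpow A k x)) (vnormalize (w ord0)).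
Proof.
move=> Alf nulf _ wlf _ nuamf nu0 nuj _ -> eig wamf w0.
pose A1 i l := Lcf (proj1 (Alf i l)); pose A2 i l := Lcf (proj2 (Alf i l)).
pose W1 j i := Lcf (proj1 (wlf j i)); pose W2 j i := Lcf (proj2 (wlf j i)).
pose nu' j := Lcf (nulf j).
have AE : A = fun i l => (lcoef (A1 i l), lcoef (A2 i l)).
  by apply/funext => i; apply/funext => l; exact: surjective_pairing.
have wE j : w j = fun i => (lcoef (W1 j i), lcoef (W2 j i)).
  by apply/funext => i; exact: surjective_pairing.
have eigE j i : _ := congr1 (@^~ i) (eig j).
have e1 j i : \sum_l (A1 i l * W1 j l - A2 i l * W2 j l) = nu' j * W1 j i.
  by apply: lcf_inj; have := eigE j i; rewrite AE wE matvecE => -[].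
have e2 j i : \sum_l (A1 i l * W2 j l + A2 i l * W1 j l) = nu' j * W2 j i.
  by apply: lcf_inj; have := eigE j i; rewrite AE wE matvecE => -[].
have xE : (fun i => \big[@cadd R/czero R]_(j < n.+1) w j i) =
    (fun i => (lcoef (\sum_j W1 j i), lcoef (\sum_j W2 j i))).
  by apply/funext => i; rewrite -big_cadd; apply: eq_bigr => j _; rewrite wE.
(* One monoid contains the supports of all eigenvalues and of all eigenvector entries. That these
   are at most finite makes the generators nonnegative. *)
have [||S hS TS] := @exponent_monoid_gen (\bigcup_j (supp (nu j) `|`
    \bigcup_i (supp (w j i).1 `|` supp (w j i).2))).
- apply: lf_set_bigcup => j; apply: lf_setU; first exact: nulf.
  by apply: lf_set_bigcup => i; apply: lf_setU; [case: (wlf j i)|case: (wlf j i)].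
- have amf_ge0 (a : LCR R) q : at_most_finite a -> supp a q -> 0 <= q.
    by move=> aamf; rewrite leNgt; apply: contraNN => /aamf->; rewrite eqxx.
  move=> q [j _ [|[i _ [|]]]]; apply: amf_ge0 => //; by case: (wamf j i).
rewrite xE AE wE; under [X in vwk_conv X]funext => k do rewrite (vpow_eigen k e1 e2).
apply: (power_iteration hS) => //.
- by move=> j q ?; apply: TS; exists j => //; left.
- by move=> j i q ?; apply: TS; exists j => //; right; exists i => //; left.
by move=> j i q ?; apply: TS; exists j => //; right; exists i => //; right.
Qed.
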